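(* Let $n$ be a positive integer, and consider integer tuples $(p,q,k,l,m,\alpha,\beta)$ with $p,q,k,l,m\ge1$, $p(k+l)+q(l+m)=n$, $0\le\alpha<k+l$ and $0\le\beta<l+m$. Among these, let $S_1=\{k<m\}$, $S_2=\{k=m,\ p<q\}$, $S_3=\{k=m,\ p=q,\ \alpha\le\beta\}$. Then $\Sigma_C=S_1\cup S_2\cup S_3$ uniquely parametrizes the $n$-square surfaces in $\mathcal H(1,1)$ with cylinder diagram $C$: every such surface is isomorphic to the surface with parameters $v$ for exactly one $v\in\Sigma_C$.
   Context: An $n$-square surface is a connected closed oriented surface obtained from $n$ unit axis-parallel squares by gluing right sides to left sides and top sides to bottom sides by translations; two are isomorphic if there is a bijection of their squares respecting right-neighbours and top-neighbours. It is in $\mathcal H(1,1)$ if it has exactly two cone points, each of angle $4\pi$. The surface with parameters $(p,q,k,l,m,\alpha,\beta)$: take two horizontal cylinders (rectangles with vertical sides identified), $C_1$ of circumference $k+l$ and height $p$, and $C_2$ of circumference $l+m$ and height $q$. There are four horizontal segments: $s_k$ of length $k$, $s_m$ of length $m$, and $l_1,l_2$ of length $l$. Bottom of $C_1$, going right from $x=0$: $s_k,l_2$. Top of $C_1$, going right from $x=\alpha$ (mod $k+l$): $s_k,l_1$. Bottom of $C_2$ from $x=0$: $s_m,l_1$. Top of $C_2$ from $x=\beta$ (mod $l+m$): $s_m,l_2$. Glue top and bottom segments of the same name by translation. An $n$-square surface has cylinder diagram $C$ if it is isomorphic to a surface obtained this way. *)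

(* Defs.v *)
From mathcomp Require Import all_boot all_fingroup.

Set Implicit Arguments.
Unset Strict Implicit.
Unset Printing Implicit Defensive.

(* Gluing right sides to left sides and top sides to bottom sides by
   translations amounts to two permutations of the squares, sending a square
   to its right neighbour and to its top neighbour. *)
Record square_gluing := SquareGluing {
  square :> finType;
  right_nb : {perm square};
  top_nb : {perm square}
}.

Definition adjacent (S : square_gluing) : rel S :=
  [rel x y | [|| y == right_nb S x, y == top_nb S x,
                 x == right_nb S y | x == top_nb S y]].

Definition n_square_surface (n : nat) (S : square_gluing) : Prop :=
  #|S| = n /\ forall x y : S, connect (@adjacent S) x y.

Definition isomorphic (S S' : square_gluing) : Prop :=
  exists f : S -> S',
    [/\ bijective f,
        forall x, f (right_nb S x) = right_nb S' (f x)
      & forall x, f (top_nb S x) = top_nb S' (f x)].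

(* (x, (h, v)) is a corner of the square x: right or left as h is true or
   false, top or bottom as v is true or false. *)
Definition corner (S : square_gluing) : finType := (S * (bool * bool))%type.

Definition glued_to (S : square_gluing) : rel (corner S) :=
  fun c d => let: (x, (h, v)) := c in let: (y, (h', v')) := d in
    [&& h, ~~ h', v == v' & y == right_nb S x]
    || [&& v, ~~ v', h == h' & y == top_nb S x].

Definition same_point (S : square_gluing) : rel (corner S) :=
  connect [rel c d | glued_to c d || glued_to d c].

Definition vertices (S : square_gluing) : {set {set corner S}} :=
  equivalence_partition (@same_point S) [set: corner S].

(* Each corner contributes pi/2, so the angle at a vertex V is #|V| * pi/2:
   regular points have #|V| = 4, and #|V| = 8 means angle 4 pi. *)
Definition cone_points (S : square_gluing) : {set {set corner S}} :=
  [set V in vertices S | #|V| != 4].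

Definition in_H11 (S : square_gluing) : Prop :=
  #|cone_points S| = 2 /\ forall V, V \in cone_points S -> #|V| = 8.

Record params := Params {
  par_p : nat; par_q : nat; par_k : nat; par_l : nat; par_m : nat;
  par_alpha : nat; par_beta : nat
}.

(* (x - a) mod w *)
Definition offset (w a : nat) (x : 'I_w) : 'I_w :=
  Ordinal (ltn_pmod (x + (w - a %% w)) (leq_ltn_trans (leq0n x) (ltn_ord x))).

Lemma offset_inj (w a : nat) : injective (@offset w a).
Proof.
move=> x y /(congr1 val) /= /eqP; rewrite eqn_modDr !modn_small //.
by move/eqP/val_inj.
Qed.

Lemma inl_pair_inj (A B C : Type) (a a' : A) (b b' : B) :
  inl C (a, b) = inl C (a', b') -> a = a' /\ b = b'.
Proof. by case. Qed.

Lemma inr_pair_inj (A B C : Type) (a a' : A) (b b' : B) :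
  inr C (a, b) = inr C (a', b') -> a = a' /\ b = b'.
Proof. by case. Qed.

Section Diagram.

Variables p q k l m alpha beta : nat.

(* inl (x, y) is the square of C_1 with lower left corner (x, y), and
   inr (x, y) that of C_2.  The circumference of C_2 is written m + l so that,
   in both cylinders, lshift embeds the first bottom segment (s_k, resp. s_m)
   and rshift the second one (l_2, resp. l_1).  For p >= 1, p.-1.+1 is the
   height p; other values are irrelevant. *)
Local Notation diagram_square :=
  ('I_(k + l) * 'I_p.-1.+1 + 'I_(m + l) * 'I_q.-1.+1)%type.

Definition diagram_right (s : diagram_square) : diagram_square :=
  match s with
  | inl (x, y) => inl (ordS x, y)
  | inr (x, y) => inr (ordS x, y)
  end.

(* On the top row, split reads off the position along the top boundary,
   starting from alpha (resp. beta): s_k then l_1 (resp. s_m then l_2). *)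
Definition diagram_top (s : diagram_square) : diagram_square :=
  match s with
  | inl (x, y) =>
      if y != ord_max then inl (x, ordS y)
      else match split (offset alpha x) with
           | inl j => inl (lshift l j, ord0)
           | inr j => inr (rshift m j, ord0)
           end
  | inr (x, y) =>
      if y != ord_max then inr (x, ordS y)
      else match split (offset beta x) with
           | inl j => inr (lshift l j, ord0)
           | inr j => inl (rshift k j, ord0)
           end
  end.

Lemma diagram_right_inj : injective diagram_right.
Proof.
move=> [[x y]|[x y]] [[x' y']|[x' y']] //=.
  by move=> e; have [/ordS_inj -> ->] := inl_pair_inj e.
by move=> e; have [/ordS_inj -> ->] := inr_pair_inj e.
Qed.

Lemma diagram_top_inj : injective diagram_top.
Proof.
have ordSN0 h (y : 'I_h.+1) : y != ord_max -> ordS y = ord0 -> False.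
  move=> yN /(congr1 val) /=; rewrite modn_small // ltnS ltn_neqAle.
  by rewrite -ltnS ltn_ord andbT; apply: contra yN => /eqP e; apply/eqP/val_inj.
have split_inj w1 w2 a (x x' : 'I_(w1 + w2)) u :
    split (offset a x) = u -> split (offset a x') = u -> x = x'.
  by move=> <- /(can_inj (@splitK w1 w2))/offset_inj.
move=> [[x y]|[x y]] [[x' y']|[x' y']] /=;
  case: (altP (y =P ord_max)) => [->|hy];
  case: (altP (y' =P ord_max)) => [->|hy'] /=;
  try (case E: (split _) => [j|j]);
  try (case E': (split _) => [j'|j']);
  move=> e; try discriminate e;
  first [have [e1 e2] := inl_pair_inj e | have [e1 e2] := inr_pair_inj e];
  try by [case: (ordSN0 _ _ hy e2) | case: (ordSN0 _ _ hy' (esym e2))].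
all: try by rewrite (ordS_inj e2) e1.
all: try by move/eqP: e1; rewrite ?eq_lrshift ?eq_rlshift.
all: first [move/lshift_inj: e1 => e1 | move/rshift_inj: e1 => e1]; subst j'.
all: by rewrite (split_inj _ _ _ _ _ _ E E').
Qed.

Definition diagram_surface : square_gluing :=
  SquareGluing (perm diagram_right_inj) (perm diagram_top_inj).

End Diagram.

Definition surface_of (v : params) : square_gluing :=
  let: Params p q k l m alpha beta := v in
  diagram_surface p q k l m alpha beta.

Definition positive_params (v : params) : Prop :=
  let: Params p q k l m _ _ := v in
  [/\ 1 <= p, 1 <= q, 1 <= k, 1 <= l & 1 <= m].

Definition has_diagram_C (S : square_gluing) : Prop :=
  exists v : params, positive_params v /\ isomorphic S (surface_of v).

Definition admissible (n : nat) (v : params) : Prop :=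
  positive_params v /\
  let: Params p q k l m alpha beta := v in
  [/\ p * (k + l) + q * (l + m) = n, alpha < k + l & beta < l + m].

Definition S1 (v : params) : Prop := par_k v < par_m v.

Definition S2 (v : params) : Prop := par_k v = par_m v /\ par_p v < par_q v.

Definition S3 (v : params) : Prop :=
  [/\ par_k v = par_m v, par_p v = par_q v & par_alpha v <= par_beta v].

Definition Sigma_C (n : nat) (v : params) : Prop :=
  admissible n v /\ [\/ S1 v, S2 v | S3 v].

(* Main.v *)
(** The vertices at the corners of a square x are governed by the commutator of
    "right" R and "top" T: the corners at the top right vertex of x are found by
    iterating the permutation comparing T R x and R T x.  In a diagram surface T and R
    commute except at four squares of the two top rows, which are swapped in
    two pairs; each pair gives a cone point of angle 4 pi.

    Failure of commutation somewhere along a row detects the top rows, so an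
    isomorphism between two diagram surfaces preserves the cylinders, up to the
    symmetry that exchanges C_1 with C_2.  If it preserves them, it preserves the
    left end of s_k on the bottom of C_1, and p, k, k + l and alpha can be read
    off by walking from that square; the same holds in C_2.  The set Sigma_C
    contains exactly one element of each orbit of the exchange symmetry. *)

Require Import Defs.
From mathcomp Require Import all_boot all_fingroup.
From mathcomp Require Import zify.

Set Implicit Arguments.
Unset Strict Implicit.
Unset Printing Implicit Defensive.

(** * Vertices of a gluing in which right and top commute up to two swaps *)

Section Vertices.

Variable S : square_gluing.

Local Notation R := (right_nb S).
Local Notation T := (top_nb S).
Local Notation same_point := (@same_point S).

(** The bottom left corner is reached by going right and then up; going up and then right may give
    another square, and this choice is where the swaps show. *)
Definition corner_at (u : S) (hv : bool * bool) : corner S :=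
  let: (h, v) := hv in
  let w := if h then u else R u in (if v then w else T w, hv).

(* A square whose top right vertex is the point of the corner c; at a cone
   point it depends on c, the bottom left corner of T (R u) being assigned u. *)
Definition vertex_square (c : corner S) : S :=
  let: (x, (h, v)) := c in
  let w := if v then x else (T^-1)%g x in if h then w else (R^-1)%g w.

Lemma corner_atK u hv : vertex_square (corner_at u hv) = u.
Proof. by case: hv => [[] []] /=; rewrite ?permK. Qed.

Lemma vertex_squareK c : corner_at (vertex_square c) c.2 = c.
Proof. by case: c => [x [[] []]] /=; rewrite ?permKV. Qed.

Lemma same_point_sym : symmetric same_point.
Proof. by apply: sym_connect_sym => c d /=; rewrite orbC. Qed.

Lemma same_point_trans : transitive same_point.
Proof. exact: connect_trans. Qed.

Lemma glued_same_point (c d : corner S) : glued_to c d -> same_point c d.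
Proof. by move=> cd; apply: connect1; rewrite /= cd. Qed.

Lemma same_point_top_right c : same_point (vertex_square c, (true, true)) c.
Proof.
have right_top x v : same_point (x, (true, v)) (R x, (false, v)).
  by apply: glued_same_point; rewrite /= !eqxx.
have top_top x h : same_point (x, (h, true)) (T x, (h, false)).
  by apply: glued_same_point; rewrite /= !eqxx orbT.
rewrite -{2}[c]vertex_squareK; move: (vertex_square c) => u.
case: c => [_ [[] []]] /=; [exact: connect0 | exact: top_top | exact: right_top |].
exact: same_point_trans (right_top _ _) (top_top _ _).
Qed.

Variables a1 b1 a2 b2 : S.
Hypothesis abU : uniq [:: a1; b1; a2; b2].
Hypothesis TR_regular :
  forall x, x \notin [:: a1; b1; a2; b2] -> T (R x) = R (T x).
Hypothesis TRa1 : T (R a1) = R (T b1).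
Hypothesis TRb1 : T (R b1) = R (T a1).
Hypothesis TRa2 : T (R a2) = R (T b2).
Hypothesis TRb2 : T (R b2) = R (T a2).

(** Chooses one square for each orbit of the two swaps, so that it can label vertices. *)
Let merge x := if x == b1 then a1 else if x == b2 then a2 else x.

Let abN : [/\ (a1 == b1) = false, (a1 == a2) = false, (a1 == b2) = false &
            [/\ (b1 == a2) = false, (b1 == b2) = false & (a2 == b2) = false]].
Proof.
move: abU; rewrite /= !inE !negb_or -!andbA.
case/and5P=> /negPf-> /negPf-> /negPf-> /negPf->.
by case/andP=> /negPf-> /andP[/negPf->].
Qed.

(** Injectivity of [R] after [T] forces [u] to be [u'] itself at a regular square and its swap
    partner at an exceptional one. *)
Lemma merge_eq u u' : R (T u) = T (R u') -> merge u = merge u'.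
Proof.
have [n1 n2 n3 [n4 n5 n6]] := abN.
have RT_inj : injective (fun x => R (T x)) by move=> x y /perm_inj/perm_inj.
rewrite /merge; have [|] := boolP (u' \in [:: a1; b1; a2; b2]); last first.
  by move/TR_regular=> -> /RT_inj->.
rewrite !inE => /or4P[] /eqP->; rewrite ?(TRa1, TRb1, TRa2, TRb2) => /RT_inj->;
  by rewrite ?eqxx ?n1 ?n2 ?n3 ?n6 // ![_ == b1]eq_sym ?n4 ?n5 ?eqxx.
Qed.

Lemma merge_same_point u :
  same_point (merge u, (true, true)) (u, (true, true)).
Proof.
(* The bottom left corner of [T (R b)] lies at the vertex of [b]; as that square is also [R (T a)],
   the corner is glued to the bottom right corner of [T a], which lies at the vertex of [a]. *)
have swap a b : T (R b) = R (T a) -> same_point (a, (true, true)) (b, (true, true)).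
  move=> TRb.
  have bD := same_point_top_right (T (R b), (false, false)).
  rewrite /= !permK TRb in bD; rewrite same_point_sym.
  apply: same_point_trans bD _; rewrite same_point_sym.
  have aD : same_point (a, (true, true)) (T a, (true, false)).
    by have := same_point_top_right (T a, (true, false)); rewrite /= permK.
  apply: same_point_trans aD _; apply: glued_same_point.
  by rewrite /= !eqxx.
rewrite /merge; case: eqP => [->|_]; first exact: swap.
by case: eqP => [->|_]; [exact: swap | exact: connect0].
Qed.

(** The label is a complete invariant of vertices: every gluing preserves it, and each corner is
    joined to the top right corner of the square labelling it. *)
Lemma same_pointE c d :
  same_point c d = (merge (vertex_square c) == merge (vertex_square d)).
Proof.
have glued_merge e f :
    glued_to e f -> merge (vertex_square e) = merge (vertex_square f).
  case: e f => [x [h v]] [y [h' v']] /= /orP[] /and4P[].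
    move=> -> /negPf-> /eqP<- /eqP->; case: v => /=; first by rewrite permK.
    (* Bottom corners across a vertical side are the only glued pairs for which [vertex_square] may
       change. *)
    by apply: merge_eq; rewrite !permKV.
  move=> -> /negPf-> /eqP<- /eqP->; by rewrite permK.
apply/idP/eqP => [/connectP[w]|cd].
  elim: w c => [c _ -> //|e w IHw c /= /andP[ce /IHw IH] /IH <-].
  by case/orP: ce => /glued_merge.
have merged e : same_point (merge (vertex_square e), (true, true)) e.
  exact: same_point_trans (merge_same_point _) (same_point_top_right _).
apply: same_point_trans (merged d); rewrite -cd same_point_sym.
exact: merged.
Qed.

Let vertex_over t : {set corner S} := [set c | merge (vertex_square c) == t].

Lemma card_vertex_over t : #|vertex_over t| = #|[set u | merge u == t]| * 4.
Proof.
have -> : vertex_over t =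
    [set corner_at p.1 p.2 | p in setX [set u | merge u == t] [set: bool * bool]].
  apply/setP=> c; rewrite inE; apply/idP/imsetP => [ct|[[u hv]]].
    exists (vertex_square c, c.2); last by rewrite vertex_squareK.
    by rewrite !inE /= ct.
  by rewrite !inE andbT /= => ut ->; rewrite corner_atK.
rewrite card_imset ?cardsX ?cardsT ?card_prod ?card_bool // => -[u hv] [u' hv'] /= e.
have := congr1 (@vertex_square) e; rewrite !corner_atK => ->.
by case: hv hv' e => [h v] [h' v'] /= [_ -> ->].
Qed.

Lemma card_merge_fiber u :
  #|[set x | merge x == merge u]| = if merge u \in [:: a1; a2] then 2 else 1.
Proof.
have [n1 n2 n3 [n4 n5 n6]] := abN.
have fiber_a1 : [set x | merge x == a1] = [set a1; b1].
  apply/setP=> x; rewrite !inE /merge.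
  case: (x =P b1) => [->|_]; rewrite ?eqxx ?orbT ?orbF //.
  by case: (x =P b2) => [->|_] //; rewrite eq_sym n2 eq_sym n3.
have fiber_a2 : [set x | merge x == a2] = [set a2; b2].
  apply/setP=> x; rewrite !inE /merge.
  case: (x =P b1) => [->|_]; first by rewrite n2 n4 n5.
  by case: (x =P b2) => _; rewrite ?eqxx ?orbT ?orbF.
rewrite !inE; case: eqP => [->|u1] /=; first by rewrite fiber_a1 cards2 n1.
case: eqP => [->|u2] /=; first by rewrite fiber_a2 cards2 n6.
suff -> : [set x | merge x == merge u] = [set u] by rewrite cards1.
have mu : merge u = u.
  by move: u1 u2; rewrite /merge; case: (u =P b1) => // _; case: (u =P b2).
apply/setP=> x; rewrite !inE; apply/eqP/eqP => [|->//].
rewrite mu in u1 u2 *; rewrite /merge; case: (x =P b1) => [_ /esym//|_].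
by case: (x =P b2) => [_ /esym//|_].
Qed.

(** A vertex has four corners for each square carrying its label: eight over [a1] and [a2], whose
    fibres are the swapped pairs, and four elsewhere. *)
Lemma two_swaps_in_H11 : in_H11 S.
Proof.
have [n1 n2 n3 [n4 n5 n6]] := abN.
have ma1 : merge a1 = a1 by rewrite /merge n1 n3.
have ma2 : merge a2 = a2 by rewrite /merge [_ == b1]eq_sym n4 n6.
have ca1 : #|vertex_over a1| = 8.
  by rewrite card_vertex_over -{1}ma1 card_merge_fiber ma1 !inE eqxx.
have ca2 : #|vertex_over a2| = 8.
  by rewrite card_vertex_over -{1}ma2 card_merge_fiber ma2 !inE eqxx orbT.
have vertexE c : [set d in [set: corner S] | same_point c d]
    = vertex_over (merge (vertex_square c)).
  by apply/setP=> d; rewrite !inE same_pointE eq_sym.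
have vertex_a a : merge a = a -> vertex_over a \in vertices S.
  by move=> ma; apply/imsetP; exists (a, (true, true)); rewrite // vertexE /= ma.
rewrite /in_H11.
have -> : cone_points S = [set vertex_over a1; vertex_over a2].
  apply/setP=> V; rewrite !inE; apply/andP/orP => [[/imsetP[c _ ->]]|].
    rewrite vertexE card_vertex_over card_merge_fiber !inE.
    case: (_ =P a1) => [-> _|_]; first by left.
    by case: (_ =P a2) => [-> _|_ //]; right.
  by case=> /eqP->; rewrite ?ca1 ?ca2 vertex_a.
split=> [|V]; last by rewrite !inE => /orP[] /eqP->.
rewrite cards2; suff -> : vertex_over a1 != vertex_over a2 by [].
apply/eqP => /setP/(_ (a1, (true, true))).
by rewrite !inE /= ma1 eqxx n2.
Qed.

End Vertices.

(** * Cyclic positions, segments and twists *)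

Lemma split_lshift m n (j : 'I_m) : split (lshift n j) = inl j.
Proof. by rewrite -[lshift n j]/(unsplit (inl j)) unsplitK. Qed.

Lemma split_rshift m n (j : 'I_n) : split (rshift m j) = inr j.
Proof. by rewrite -[rshift m j]/(unsplit (inr j)) unsplitK. Qed.

Lemma val_iter_ordS n i (x : 'I_n) : nat_of_ord (iter i (@ordS n) x) = (x + i) %% n.
Proof.
elim: i => [|i IHi] /=; first by rewrite addn0 modn_small.
by rewrite IHi -addn1 modnDml addn1 addnS.
Qed.

Lemma iter_ordS_onto n (x y : 'I_n) : exists i, iter i (@ordS _) x = y.
Proof.
exists (y + (n - x)); apply/val_inj; rewrite /= val_iter_ordS.
by rewrite addnCA subnKC ?modnDr ?modn_small // ltnW.
Qed.

Lemma offset_ordS w a (x : 'I_w) : offset a (ordS x) = ordS (offset a x).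
Proof.
by apply/val_inj; rewrite /= modnDml -[in RHS]addn1 modnDml addSn addn1.
Qed.

Lemma offset_onto w a (u : 'I_w) : exists x, offset a x = u.
Proof.
have [g _ gK] := injF_bij (@offset_inj w a).
by exists (g u).
Qed.

Lemma ordS_lshift m n (i i' : 'I_m) :
  i.+1 = i' -> ordS (lshift n i) = lshift n i'.
Proof.
by move=> ii'; apply/val_inj; rewrite /= ii' modn_small // ltn_addr.
Qed.

Lemma ordS_rshift m n (j j' : 'I_n) :
  j.+1 = j' -> ordS (rshift m j) = rshift m j'.
Proof.
by move=> jj'; apply/val_inj; rewrite /= -addnS jj' modn_small // ltn_add2l.
Qed.

Lemma ordS_lshift_last m n (i : 'I_m) (j : 'I_n) :
  i.+1 = m -> j = 0 :> nat -> ordS (lshift n i) = rshift m j.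
Proof.
move=> im j0; apply/val_inj; rewrite /= im j0 addn0 modn_small //.
by have := ltn_ord j; lia.
Qed.

Lemma ordS_rshift_last m n (i : 'I_m) (j : 'I_n) :
  j.+1 = n -> i = 0 :> nat -> ordS (rshift m j) = lshift n i.
Proof. by move=> jn i0; apply/val_inj; rewrite /= -addnS jn i0 modnn. Qed.

(** * The geometry of a single diagram surface *)

Section Diagram.

Variables p q k l m a b : nat.

Local Notation D := (diagram_surface p q k l m a b).
Local Notation R := (right_nb D).
Local Notation T := (top_nb D).

Definition in_C1 (s : D) : bool := if s is inl _ then true else false.

Definition in_top_row (s : D) : bool :=
  match s with inl (_, y) => y == ord_max | inr (_, y) => y == ord_max end.

(** Swapping the summands is well typed because the circumferences are written [k + l] and [m + l];
    the roles of l_1 and l_2 are swapped as well. *)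
Definition exchange (s : D) : diagram_surface q p m l k b a :=
  match s with inl s => inr s | inr s => inl s end.

Lemma right_C1 x y : R (inl (x, y)) = inl (ordS x, y).
Proof. by rewrite permE. Qed.

Lemma right_C2 x y : R (inr (x, y)) = inr (ordS x, y).
Proof. by rewrite permE. Qed.

Lemma iter_right_C1 i x y : iter i R (inl (x, y)) = inl (iter i (@ordS _) x, y).
Proof. by elim: i => //= i ->; rewrite right_C1. Qed.

Lemma iter_right_C2 i x y : iter i R (inr (x, y)) = inr (iter i (@ordS _) x, y).
Proof. by elim: i => //= i ->; rewrite right_C2. Qed.

Lemma in_C1_right s : in_C1 (R s) = in_C1 s.
Proof. by case: s => [[x y]|[x y]]; rewrite ?right_C1 ?right_C2. Qed.

Lemma in_top_row_iter_right i s : in_top_row (iter i R s) = in_top_row s.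
Proof. by case: s => [[x y]|[x y]]; rewrite ?iter_right_C1 ?iter_right_C2. Qed.

Lemma top_C1 x y : y != ord_max -> T (inl (x, y)) = inl (x, ordS y).
Proof. by move=> yN; rewrite permE /= yN. Qed.

Lemma top_C2 x y : y != ord_max -> T (inr (x, y)) = inr (x, ordS y).
Proof. by move=> yN; rewrite permE /= yN. Qed.

Lemma top_s_k x j :
  offset a x = lshift l j -> T (inl (x, ord_max)) = inl (lshift l j, ord0).
Proof. by move=> xj; rewrite permE /= eqxx /= xj split_lshift. Qed.

Lemma top_l_1 x j :
  offset a x = rshift k j -> T (inl (x, ord_max)) = inr (rshift m j, ord0).
Proof. by move=> xj; rewrite permE /= eqxx /= xj split_rshift. Qed.

Lemma top_s_m x j :
  offset b x = lshift l j -> T (inr (x, ord_max)) = inr (lshift l j, ord0).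
Proof. by move=> xj; rewrite permE /= eqxx /= xj split_lshift. Qed.

Lemma top_l_2 x j :
  offset b x = rshift m j -> T (inr (x, ord_max)) = inl (rshift k j, ord0).
Proof. by move=> xj; rewrite permE /= eqxx /= xj split_rshift. Qed.

Lemma top_right_below s : ~~ in_top_row s -> T (R s) = R (T s).
Proof.
by case: s => [[x y]|[x y]] yN;
  rewrite ?right_C1 ?right_C2 ?(top_C1 _ yN) ?(top_C2 _ yN) ?right_C1 ?right_C2.
Qed.

(** Descending inside the cylinder leads to the bottom row, and rotating it reaches all its squares.
    Applied to reachability for connectedness, and to the cylinder of the image under an
    isomorphism. *)
Lemma cylinder_invariant (A : Type) (c : D -> A) :
    (forall s, c (R s) = c s) ->
    (forall s, ~~ in_top_row s -> c (T s) = c s) ->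
  (forall z z', c (inl z) = c (inl z')) /\ (forall z z', c (inr z) = c (inr z')).
Proof.
move=> cR cT.
have c_iter i s : c (iter i R s) = c s by elim: i => //= i <-.
have bottom1 n (ltn : n < p.-1.+1) x :
    c (inl (x, Ordinal ltn)) = c (inl (x, ord0)).
  elim: n ltn => [|n IHn] ltn; first by congr (c (inl (_, _))); apply/val_inj.
  have yN : Ordinal (ltnW ltn) != ord_max by rewrite -val_eqE /= neq_ltn -ltnS ltn.
  rewrite -(IHn (ltnW ltn)) -[RHS]cT ?top_C1 //.
  by congr (c (inl (_, _))); apply/val_inj; rewrite /= modn_small.
have bottom2 n (ltn : n < q.-1.+1) x :
    c (inr (x, Ordinal ltn)) = c (inr (x, ord0)).
  elim: n ltn => [|n IHn] ltn; first by congr (c (inr (_, _))); apply/val_inj.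
  have yN : Ordinal (ltnW ltn) != ord_max by rewrite -val_eqE /= neq_ltn -ltnS ltn.
  rewrite -(IHn (ltnW ltn)) -[RHS]cT ?top_C2 //.
  by congr (c (inr (_, _))); apply/val_inj; rewrite /= modn_small.
split=> -[x [y yp]] [x' [y' yp']]; rewrite ?bottom1 ?bottom2;
  have [i <-] := iter_ordS_onto x x'.
  by rewrite -iter_right_C1 c_iter.
by rewrite -iter_right_C2 c_iter.
Qed.

Lemma exchange_right s :
  exchange (R s) = right_nb (diagram_surface q p m l k b a) (exchange s).
Proof. by rewrite !permE; case: s => [[x y]|[x y]]. Qed.

Lemma exchange_top s :
  exchange (T s) = top_nb (diagram_surface q p m l k b a) (exchange s).
Proof.
rewrite !permE; case: s => [[x y]|[x y]] /=; case: (y != ord_max) => //.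
  by case: (split _).
by case: (split _).
Qed.

Hypotheses (k_gt0 : 0 < k) (l_gt0 : 0 < l) (m_gt0 : 0 < m).

Definition left_end_s_k : D := inl (lshift l (Ordinal k_gt0), ord0).

Let last_ord n (n_gt0 : 0 < n) : exists i : 'I_n, i.+1 = n.
Proof.
have lt : n.-1 < n by rewrite prednK.
by exists (Ordinal lt); rewrite /= prednK.
Qed.

(** Take the square under the right end of s_k: going up first stays in C_1, while going right first
    passes under l_1 and leads up into C_2. *)
Lemma defect_C1 : exists x : 'I_(k + l),
  T (R (inl (x, ord_max))) <> R (T (inl (x, ord_max))).
Proof.
have [k1 k1E] := last_ord k_gt0; pose l0 : 'I_l := Ordinal l_gt0.
have [x xE] := offset_onto a (lshift l k1).
exists x => /(congr1 in_C1); rewrite right_C1 (top_s_k xE) right_C1.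
have /top_l_1-> // : offset a (ordS x) = rshift k l0.
by rewrite offset_ordS xE (ordS_lshift_last (j := l0) k1E).
Qed.

Lemma defect_C2 : exists x : 'I_(m + l),
  T (R (inr (x, ord_max))) <> R (T (inr (x, ord_max))).
Proof.
have [m1 m1E] := last_ord m_gt0; pose l0 : 'I_l := Ordinal l_gt0.
have [x xE] := offset_onto b (lshift l m1).
exists x => /(congr1 in_C1); rewrite right_C2 (top_s_m xE) right_C2.
have /top_l_2-> // : offset b (ordS x) = rshift m l0.
by rewrite offset_ordS xE (ordS_lshift_last (j := l0) m1E).
Qed.

(** This describes the top rows by [R] and [T] alone, which makes them invariant under isomorphism.
    Rotating a top row always meets the defect found above. *)
Lemma in_top_rowP s :
  in_top_row s <-> exists i, T (R (iter i R s)) <> R (T (iter i R s)).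
Proof.
split=> [|[i iP]]; last first.
  apply: contra_notT iP => sN.
  by apply: top_right_below; rewrite in_top_row_iter_right.
case: s => [[x y]|[x y]] /= /eqP->.
  have [x' x'P] := defect_C1; have [i ix'] := iter_ordS_onto x x'.
  by exists i; rewrite iter_right_C1 ix'.
have [x' x'P] := defect_C2; have [i ix'] := iter_ordS_onto x x'.
by exists i; rewrite iter_right_C2 ix'.
Qed.

(** The exceptional squares lie under the right ends of s_k, l_1, s_m and l_2. The ends of s_k and
    s_m form one swapped pair, since l_1 follows s_k on top of C_1 and s_m on the bottom of C_2, and
    l_2 follows them in the other two places; the ends of l_1 and l_2 form the other pair. *)
Lemma in_H11_diagram : in_H11 D.
Proof.
have [k1 k1E] := last_ord k_gt0; pose k0 : 'I_k := Ordinal k_gt0.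
have [l1 l1E] := last_ord l_gt0; pose l0 : 'I_l := Ordinal l_gt0.
have [m1 m1E] := last_ord m_gt0; pose m0 : 'I_m := Ordinal m_gt0.
have [x1 x1E] := offset_onto a (lshift l k1).
have [x2 x2E] := offset_onto a (rshift k l1).
have [y1 y1E] := offset_onto b (lshift l m1).
have [y2 y2E] := offset_onto b (rshift m l1).
have ordSx1 : offset a (ordS x1) = rshift k l0.
  by rewrite offset_ordS x1E (ordS_lshift_last (j := l0) k1E).
have ordSx2 : offset a (ordS x2) = lshift l k0.
  by rewrite offset_ordS x2E (ordS_rshift_last (i := k0) l1E).
have ordSy1 : offset b (ordS y1) = rshift m l0.
  by rewrite offset_ordS y1E (ordS_lshift_last (j := l0) m1E).
have ordSy2 : offset b (ordS y2) = lshift l m0.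
  by rewrite offset_ordS y2E (ordS_rshift_last (i := m0) l1E).
have x12 : x1 != x2.
  apply/eqP=> x12; move: x2E; rewrite -x12 x1E => /eqP.
  by rewrite eq_lrshift.
have y12 : y1 != y2.
  apply/eqP=> y12; move: y2E; rewrite -y12 y1E => /eqP.
  by rewrite eq_lrshift.
apply: (@two_swaps_in_H11 D (inl (x1, ord_max)) (inr (y1, ord_max))
                            (inl (x2, ord_max)) (inr (y2, ord_max))).
- have eq_inl x x' y : (inl (x, y) == inl (x', y) :> D) = (x == x').
    by apply/eqP/eqP => [[]|->].
  have eq_inr x x' y : (inr (x, y) == inr (x', y) :> D) = (x == x').
    by apply/eqP/eqP => [[]|->].
  by rewrite /= !inE !eq_inl !eq_inr (negPf x12) (negPf y12).
(* Away from the four ends, a top square and its right neighbour lie under the same segment, which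
   is glued by a translation. *)
- move=> s; have [|/top_right_below//] := boolP (in_top_row s).
  rewrite !inE; case: s => [[x y]|[x y]] /= /eqP-> sN; rewrite ?right_C1 ?right_C2.
    case: (split_ordP (offset a x)) => j jE.
      have jk : j.+1 < k.
        rewrite ltn_neqAle ltn_ord andbT; apply: contra sN => /eqP jk.
        rewrite (_ : x = x1) ?eqxx //; apply: (@offset_inj _ a).
        by rewrite jE x1E; congr lshift; apply/val_inj/succn_inj; rewrite /= jk k1E.
      rewrite (top_s_k jE) right_C1 (@ordS_lshift _ _ _ (Ordinal jk)) //.
      by apply: top_s_k; rewrite offset_ordS jE; apply: ordS_lshift.
    have jl : j.+1 < l.
      rewrite ltn_neqAle ltn_ord andbT; apply: contra sN => /eqP jl.
      rewrite (_ : x = x2) ?eqxx ?orbT //; apply: (@offset_inj _ a).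
      by rewrite jE x2E; congr rshift; apply/val_inj/succn_inj; rewrite /= jl l1E.
    rewrite (top_l_1 jE) right_C2 (@ordS_rshift _ _ _ (Ordinal jl)) //.
    by apply: top_l_1; rewrite offset_ordS jE; apply: ordS_rshift.
  case: (split_ordP (offset b x)) => j jE.
    have jm : j.+1 < m.
      rewrite ltn_neqAle ltn_ord andbT; apply: contra sN => /eqP jm.
      rewrite (_ : x = y1) ?eqxx ?orbT //; apply: (@offset_inj _ b).
      by rewrite jE y1E; congr lshift; apply/val_inj/succn_inj; rewrite /= jm m1E.
    rewrite (top_s_m jE) right_C2 (@ordS_lshift _ _ _ (Ordinal jm)) //.
    by apply: top_s_m; rewrite offset_ordS jE; apply: ordS_lshift.
  have jl : j.+1 < l.
    rewrite ltn_neqAle ltn_ord andbT; apply: contra sN => /eqP jl.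
    rewrite (_ : x = y2) ?eqxx ?orbT //; apply: (@offset_inj _ b).
    by rewrite jE y2E; congr rshift; apply/val_inj/succn_inj; rewrite /= jl l1E.
  rewrite (top_l_2 jE) right_C1 (@ordS_rshift _ _ _ (Ordinal jl)) //.
  by apply: top_l_2; rewrite offset_ordS jE; apply: ordS_rshift.
- rewrite right_C1 (top_l_1 ordSx1) (top_s_m y1E) right_C2.
  by rewrite (ordS_lshift_last (j := l0) m1E).
- rewrite right_C2 (top_l_2 ordSy1) (top_s_k x1E) right_C1.
  by rewrite (ordS_lshift_last (j := l0) k1E).
- rewrite right_C1 (top_s_k ordSx2) (top_l_2 y2E) right_C1.
  by rewrite (ordS_rshift_last (i := k0) l1E).
- rewrite right_C2 (top_s_m ordSy2) (top_l_1 x2E) right_C2.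
  by rewrite (ordS_rshift_last (i := m0) l1E).
Qed.

(** Reachability from [s] is constant on each cylinder, and a square under l_1 links the two. *)
Lemma connected_diagram (s t : D) : connect (@adjacent D) s t.
Proof.
have adj_sym : connect_sym (@adjacent D).
  by apply: sym_connect_sym => x y; rewrite /adjacent /= orbA orbC -orbA.
have adjR x : adjacent x (R x) by rewrite /adjacent /= eqxx.
have adjT x : adjacent x (T x) by rewrite /adjacent /= eqxx orbT.
have cR x : connect (@adjacent D) s (R x) = connect (@adjacent D) s x.
  exact/esym/(same_connect_r adj_sym)/connect1.
have cT x : connect (@adjacent D) s (T x) = connect (@adjacent D) s x.
  exact/esym/(same_connect_r adj_sym)/connect1.
have [c_inl c_inr] := cylinder_invariant cR (fun x _ => cT x).
have [x /top_l_1 Tx] := offset_onto a (rshift k (Ordinal l_gt0)).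
have := connect0 (@adjacent D) s.
have bridge := cT (inl (x, ord_max)); rewrite Tx in bridge.
suff -> : connect (@adjacent D) s s = connect (@adjacent D) s t by [].
have const r : connect (@adjacent D) s r = connect (@adjacent D) s (inl (x, ord_max)).
  by case: r => r; [exact: c_inl | rewrite -bridge; exact: c_inr].
by rewrite !const.
Qed.

Lemma card_diagram : 0 < p -> 0 < q -> #|D| = p * (k + l) + q * (l + m).
Proof.
move=> p_gt0 q_gt0.
by rewrite card_sum !card_prod !card_ord !prednK // mulnC [m + l]addnC [_ * q]mulnC.
Qed.

(* The square at the left end of s_k on the bottom of C_1 is the only square of
   C_1 lying above C_1 whose left neighbour lies above C_2. *)
Lemma left_end_s_k_unique s z : in_C1 s -> in_C1 (T s) -> ~~ in_C1 z ->
  T s = R (T z) -> T s = left_end_s_k.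
Proof.
case: z => // -[zx zy] s1 Ts1 _ TsRTz.
have zT : zy = ord_max.
  apply/eqP; apply: contraTT Ts1 => zyN.
  by rewrite TsRTz top_C2 // right_C2.
rewrite zT in TsRTz.
move: TsRTz; case: (split_ordP (offset b zx)) => j jE.
  by move=> TsRTz; move: Ts1; rewrite TsRTz (top_s_m jE) right_C2.
rewrite (top_l_2 jE) right_C1; case: s s1 Ts1 => // -[x y] _.
have [->|yN] := eqVneq y ord_max; last first.
  rewrite top_C1 // => _ e; have [_ /(congr1 val)/eqP] := inl_pair_inj e.
  rewrite /= modn_small // ltn_neqAle ltn_ord andbT.
  by apply: contra yN => /eqP[yp]; apply/eqP/val_inj.
case: (split_ordP (offset a x)) => i iE; last by rewrite (top_l_1 iE).
rewrite (top_s_k iE) => _ e; have [ij _] := inl_pair_inj e; congr (inl (_, _)).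
apply/val_inj => /=; have /= := congr1 val ij.
(* The right neighbour of position [k + j] is 0 if [j] is last on l_2; otherwise it is [k + j + 1],
   beyond the position [i < k] on s_k. *)
have [jl|jl] := eqVneq j.+1 l; first by rewrite -addnS jl modnn.
rewrite -addnS modn_small; last by rewrite ltn_add2l ltn_neqAle jl ltn_ord.
by move=> ei; have := ltn_ord i; rewrite ei ltnNge leq_addr.
Qed.

(** The witnesses lie under the left end of s_k on top of C_1 and under the right end of l_2 on top
    of C_2. *)
Lemma left_end_s_k_exists : exists s z,
  [/\ in_C1 s, ~~ in_C1 z, T s = R (T z) & T s = left_end_s_k].
Proof.
have [l1 l1E] := last_ord l_gt0.
have [x xE] := offset_onto a (lshift l (Ordinal k_gt0)).
have [z zE] := offset_onto b (rshift m l1).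
exists (inl (x, ord_max)), (inr (z, ord_max)); split=> //; last exact: top_s_k.
by rewrite (top_s_k xE) (top_l_2 zE) right_C1 (ordS_rshift_last (i := Ordinal k_gt0)).
Qed.

Lemma iter_top_C1 i x : i < p.-1.+1 -> iter i T (inl (x, ord0)) = inl (x, inord i).
Proof.
elim: i => [|i IHi] ip.
  by congr (inl (_, _)); apply/val_inj; rewrite /= inordK.
have lt_ip := ltnW ip.
have yN : inord i != ord_max :> 'I_p.-1.+1 by rewrite -val_eqE /= inordK // ltn_eqF.
rewrite iterS (IHi lt_ip) (top_C1 _ yN); congr (inl (_, _)).
by apply/val_inj; rewrite /= !inordK // modn_small.
Qed.

(** This closed walk encodes the twist: climb to the top row, go right by [a] to get under the left
    end of s_k, and cross it. *)
Lemma top_left_end_s_k :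
  T (iter a R (iter p.-1 T left_end_s_k)) = left_end_s_k.
Proof.
rewrite iter_top_C1 // iter_right_C1 (_ : inord p.-1 = ord_max); last first.
  by apply/val_inj; rewrite /= inordK.
apply: top_s_k; apply/val_inj; rewrite /= val_iter_ordS add0n.
by rewrite subnKC ?modnn // ltnW // ltn_pmod // addn_gt0 k_gt0.
Qed.

End Diagram.

(** * Isomorphisms of gluings *)

Definition gluing_iso (S S' : square_gluing) (f : S -> S') : Prop :=
  [/\ bijective f,
      forall x, f (right_nb S x) = right_nb S' (f x)
    & forall x, f (top_nb S x) = top_nb S' (f x)].

Lemma gluing_iso_inv (S S' : square_gluing) (f : S -> S') (g : S' -> S) :
  cancel f g -> cancel g f -> gluing_iso f -> gluing_iso g.
Proof.
move=> fK gK [_ fR fT]; split=> [|x|x]; first by exists f.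
  by apply: (can_inj fK); rewrite fR !gK.
by apply: (can_inj fK); rewrite fT !gK.
Qed.

Lemma gluing_iso_comp (S S' S'' : square_gluing) (f : S -> S') (g : S' -> S'') :
  gluing_iso f -> gluing_iso g -> gluing_iso (g \o f).
Proof.
move=> [f_bij fR fT] [g_bij gR gT]; split=> [|x|x]; first exact: bij_comp.
  by rewrite /= fR gR.
by rewrite /= fT gT.
Qed.

Lemma gluing_iso_iter_right (S S' : square_gluing) (f : S -> S') i x :
  gluing_iso f -> f (iter i (right_nb S) x) = iter i (right_nb S') (f x).
Proof. by case=> _ fR _; elim: i => //= i <-. Qed.

Lemma gluing_iso_iter_top (S S' : square_gluing) (f : S -> S') i x :
  gluing_iso f -> f (iter i (top_nb S) x) = iter i (top_nb S') (f x).
Proof. by case=> _ _ fT; elim: i => //= i <-. Qed.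

Lemma gluing_iso_exchange p q k l m a b : gluing_iso (@exchange p q k l m a b).
Proof.
split; [|exact: exchange_right|exact: exchange_top].
by exists (@exchange q p m l k b a) => -[].
Qed.

Lemma in_C1_exchange p q k l m a b (s : diagram_surface p q k l m a b) :
  in_C1 (exchange s) = ~~ in_C1 s.
Proof. by case: s. Qed.

(** * Rigidity of isomorphisms between diagram surfaces *)

Section Rigidity.

Variables p q k l m a b p' q' k' l' m' a' b' : nat.

Local Notation D := (diagram_surface p q k l m a b).
Local Notation D' := (diagram_surface p' q' k' l' m' a' b').

Hypotheses (k_gt0 : 0 < k) (l_gt0 : 0 < l) (m_gt0 : 0 < m).
Hypotheses (k'_gt0 : 0 < k') (l'_gt0 : 0 < l') (m'_gt0 : 0 < m').

Variable f : D -> D'.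
Hypothesis f_iso : gluing_iso f.

Lemma iso_top_row s : in_top_row (f s) = in_top_row s.
Proof.
have [f_bij fR fT] := f_iso.
apply/idP/idP => /in_top_rowP top; apply/in_top_rowP => //.
  have [//|//|//|i iP] := top; exists i => TR; apply: iP.
  by rewrite -gluing_iso_iter_right // -fR -!fT TR fR.
have [//|//|//|i iP] := top; exists i => TR; apply: iP.
by apply: (bij_inj f_bij); rewrite fT !fR fT gluing_iso_iter_right.
Qed.

(** The cylinder containing [f s] depends only on the cylinder of [s], because [f] preserves top
    rows. *)
Lemma iso_cylinders :
  (forall s, in_C1 (f s) = in_C1 s) \/ (forall s, in_C1 (f s) = ~~ in_C1 s).
Proof.
have [[g fK gK] fR fT] := f_iso.
have cR s : in_C1 (f (right_nb D s)) = in_C1 (f s) by rewrite fR in_C1_right.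
have cT s : ~~ in_top_row s -> in_C1 (f (top_nb D s)) = in_C1 (f s).
  rewrite fT -iso_top_row; case: (f s) => [[x y]|[x y]] yN.
    by rewrite top_C1.
  by rewrite top_C2.
have [c_inl c_inr] := cylinder_invariant cR cT.
have x1 : 'I_(k + l) := lshift l (Ordinal k_gt0).
have x2 : 'I_(m + l) := lshift l (Ordinal m_gt0).
have x1' : 'I_(k' + l') := lshift l' (Ordinal k'_gt0).
have x2' : 'I_(m' + l') := lshift l' (Ordinal m'_gt0).
(* Otherwise the whole image would lie in one cylinder, against surjectivity. *)
have c_neq : in_C1 (f (inl (x1, ord0))) <> in_C1 (f (inr (x2, ord0))).
  move=> c12; have c_const s : in_C1 (f s) = in_C1 (f (inl (x1, ord0))).
    by case: s => s; [exact: c_inl | rewrite c12; exact: c_inr].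
  have := c_const (g (inl (x1', ord0))).
  by rewrite -(c_const (g (inr (x2', ord0)))) !gK.
have {c_neq}c12 : in_C1 (f (inr (x2, ord0))) = ~~ in_C1 (f (inl (x1, ord0))).
  by move: c_neq; do 2!case: in_C1.
case c1: (in_C1 (f (inl (x1, ord0)))); [left | right] => -[z|z];
  by rewrite ?(c_inl z (x1, ord0)) ?(c_inr z (x2, ord0)) ?c12 c1.
Qed.

Hypothesis f_C1 : forall s, in_C1 (f s) = in_C1 s.

Local Notation base := (@left_end_s_k p q k l m a b k_gt0).
Local Notation base' := (@left_end_s_k p' q' k' l' m' a' b' k'_gt0).

Lemma iso_left_end_s_k : f base = base'.
Proof.
have [_ fR fT] := f_iso.
have [s [z [s1 z2 TsRTz Ts]]] := left_end_s_k_exists p q m a b k_gt0 l_gt0.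
have fz2 : ~~ in_C1 (f z) by rewrite f_C1.
rewrite -Ts fT; apply: (left_end_s_k_unique k'_gt0 _ _ fz2).
- by rewrite f_C1.
- by rewrite -fT f_C1 Ts.
- by rewrite -!fT -fR TsRTz.
Qed.

(** Going right [k + l] times from the base square returns to it, hence so does the image walk. *)
Lemma iso_circumference_dvd : k' + l' %| k + l.
Proof.
have := gluing_iso_iter_right (k + l) base f_iso.
rewrite iso_left_end_s_k !iter_right_C1.
rewrite (_ : iter _ _ _ = lshift l (Ordinal k_gt0)); last first.
  by apply/val_inj; rewrite /= val_iter_ordS add0n modnn.
rewrite iso_left_end_s_k => e; have [/(congr1 val) /= + _] := inl_pair_inj e.
by rewrite val_iter_ordS add0n => /esym/eqP.
Qed.

(** If C_1 were lower in [D'], climbing from the base squares would reach the top row there while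
    still below it in [D]. *)
Lemma iso_height_le : p.-1 <= p'.-1.
Proof.
rewrite leqNgt; apply/negP => lt_p'p.
have := gluing_iso_iter_top p'.-1 base f_iso.
rewrite iso_left_end_s_k !iter_top_C1 ?ltnS //; last exact: ltnW.
move/(congr1 (@in_top_row _ _ _ _ _ _ _)); rewrite iso_top_row /= -!val_eqE /=.
rewrite !inordK ?eqxx ?ltnS //; last exact: ltnW.
by rewrite ltn_eqF.
Qed.

(** If [k' < k], then [k'] steps right of the base one is still on s_k, above C_1, whereas the image
    walk has reached l_2, above C_2. *)
Lemma iso_s_k_le : k <= k'.
Proof.
have [_ _ fT] := f_iso; rewrite leqNgt; apply/negP => k'k.
have [x /top_s_k Tx] := offset_onto a (lshift l (Ordinal k'k)).
have [z /top_l_2 Tz] := offset_onto b' (rshift m' (Ordinal l'_gt0)).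
have := gluing_iso_iter_right k' base f_iso.
rewrite iso_left_end_s_k !iter_right_C1.
rewrite (_ : iter _ _ _ = lshift l (Ordinal k'k)); last first.
  by apply/val_inj; rewrite /= val_iter_ordS add0n modn_small // ltn_addr.
rewrite -(Tx p q m b) fT.
rewrite (_ : iter _ _ _ = rshift k' (Ordinal l'_gt0)); last first.
  apply/val_inj; rewrite /= val_iter_ordS add0n addn0 modn_small //.
  by rewrite -[ltnLHS]addn0 ltn_add2l.
by rewrite -Tz => /perm_inj/(congr1 (@in_C1 _ _ _ _ _ _ _)); rewrite f_C1.
Qed.

(** Compare the closed walks of [top_left_end_s_k]: with equal heights and matching base squares,
    cancelling the last [T] leaves two positions in one row. *)
Lemma iso_twist : p.-1 = p'.-1 -> k + l = k' + l' -> a = a' %[mod k + l].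
Proof.
move=> pp' ww'; have [_ _ fT] := f_iso.
have /(congr1 f) := top_left_end_s_k p q l m a b k_gt0.
rewrite fT gluing_iso_iter_right // gluing_iso_iter_top // iso_left_end_s_k.
rewrite -{2}(top_left_end_s_k p' q' l' m' a' b' k'_gt0) pp' => /perm_inj.
rewrite /left_end_s_k (iter_top_C1 _ _ _ _ _ (ltnSn _)) !iter_right_C1 => e.
have [/(congr1 val) /= + _] := inl_pair_inj e.
by rewrite !val_iter_ordS !add0n ww'.
Qed.

End Rigidity.

(** The one-sided bounds become equalities when applied also to the inverse isomorphism. *)
Lemma iso_C1_params p q k l m a b p' q' k' l' m' a' b'
    (f : diagram_surface p q k l m a b -> diagram_surface p' q' k' l' m' a' b') :
    0 < k -> 0 < l -> 0 < m -> 0 < k' -> 0 < l' -> 0 < m' ->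
    gluing_iso f -> (forall s, in_C1 (f s) = in_C1 s) ->
  [/\ p.-1 = p'.-1, k = k', l = l' & a = a' %[mod k + l]].
Proof.
move=> k_gt0 l_gt0 m_gt0 k'_gt0 l'_gt0 m'_gt0 f_iso f_C1.
have [[g fK gK] _ _] := f_iso.
have g_iso := gluing_iso_inv fK gK f_iso.
have g_C1 s : in_C1 (g s) = in_C1 s by rewrite -f_C1 gK.
have pp' : p.-1 = p'.-1.
  apply/eqP; rewrite eqn_leq.
  rewrite (iso_height_le k_gt0 l_gt0 m_gt0 k'_gt0 l'_gt0 m'_gt0 f_iso f_C1).
  exact: (iso_height_le k'_gt0 l'_gt0 m'_gt0 k_gt0 l_gt0 m_gt0 g_iso g_C1).
have kk' : k = k'.
  apply/eqP; rewrite eqn_leq.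
  rewrite (iso_s_k_le k_gt0 l_gt0 k'_gt0 l'_gt0 f_iso f_C1).
  exact: (iso_s_k_le k'_gt0 l'_gt0 k_gt0 l_gt0 g_iso g_C1).
have ww' : k + l = k' + l'.
  apply/eqP; rewrite eqn_dvd.
  rewrite (iso_circumference_dvd k_gt0 l_gt0 k'_gt0 f_iso f_C1) andbT.
  exact: (iso_circumference_dvd k'_gt0 l'_gt0 k_gt0 g_iso g_C1).
split=> //; first by apply/eqP; rewrite -(eqn_add2l k) ww' kk'.
exact: (iso_twist k_gt0 l_gt0 k'_gt0 f_iso f_C1).
Qed.

(** * The exchange symmetry and its fundamental domain *)

Definition exchange_params (v : params) : params :=
  let: Params p q k l m a b := v in Params q p m l k b a.

Lemma isomorphic_sym S S' : isomorphic S S' -> isomorphic S' S.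
Proof.
move=> [f f_iso]; have [[g fK gK] _ _] := f_iso.
by exists g; exact: gluing_iso_inv fK gK f_iso.
Qed.

Lemma isomorphic_trans S S' S'' :
  isomorphic S S' -> isomorphic S' S'' -> isomorphic S S''.
Proof.
by move=> [f f_iso] [g g_iso]; exists (g \o f); exact: gluing_iso_comp f_iso g_iso.
Qed.

Lemma isomorphic_exchange v : isomorphic (surface_of v) (surface_of (exchange_params v)).
Proof. by case: v => p q k l m a b; eexists; exact: gluing_iso_exchange. Qed.

Lemma offset_modn w a (x : 'I_w) : offset (a %% w) x = offset a x.
Proof. by apply/val_inj; rewrite /= modn_mod. Qed.

Lemma isomorphic_modn p q k l m a b :
  isomorphic (diagram_surface p q k l m a b)
    (diagram_surface p q k l m (a %% (k + l)) (b %% (m + l))).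
Proof.
exists id; split=> [|x|x]; [by exists id | by rewrite !permE | rewrite !permE].
by case: x => [[x y]|[x y]] /=; rewrite offset_modn.
Qed.

Lemma admissible_exchange n v : admissible n v -> admissible n (exchange_params v).
Proof.
case: v => p q k l m a b [[p_gt0 q_gt0 k_gt0 l_gt0 m_gt0] [nE ltak ltbm]].
by split; split; rewrite // ?[m + l]addnC ?[l + k]addnC // addnC.
Qed.

Lemma iso_params_eq n p q k l m a b p' q' k' l' m' a' b'
    (f : diagram_surface p q k l m a b -> diagram_surface p' q' k' l' m' a' b') :
    admissible n (Params p q k l m a b) ->
    admissible n (Params p' q' k' l' m' a' b') ->
    gluing_iso f -> (forall s, in_C1 (f s) = in_C1 s) ->
  Params p q k l m a b = Params p' q' k' l' m' a' b'.
Proof.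
move=> [[p0 q0 k0 l0 m0] [_ ltak ltbm]] [[p'0 q'0 k'0 l'0 m'0] [_ lta'k ltb'm]].
move=> f_iso f_C1.
(* Conjugating by the exchange turns C_2 into C_1, so the same lemma yields [q], [m] and [b]. *)
pose h := @exchange p' q' k' l' m' a' b' \o f \o @exchange q p m l k b a.
have h_iso : gluing_iso h.
  apply: gluing_iso_comp (gluing_iso_exchange _ _ _ _ _ _ _).
  exact: gluing_iso_comp (gluing_iso_exchange _ _ _ _ _ _ _) f_iso.
have h_C1 s : in_C1 (h s) = in_C1 s.
  by rewrite in_C1_exchange f_C1 in_C1_exchange negbK.
have [pp' kk' ll' aa'] := iso_C1_params k0 l0 m0 k'0 l'0 m'0 f_iso f_C1.
have [qq' mm' _ bb'] := iso_C1_params m0 l0 k0 m'0 l'0 k'0 h_iso h_C1.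
rewrite -(prednK p0) -(prednK q0) pp' qq' !prednK //; subst k' l' m'.
rewrite !modn_small // in aa'; rewrite [m + l]addnC !modn_small // in bb'.
by rewrite aa' bb'.
Qed.

Lemma isomorphic_admissible n v w :
    admissible n v -> admissible n w ->
    isomorphic (surface_of v) (surface_of w) ->
  v = w \/ v = exchange_params w.
Proof.
case: v w => p q k l m a b [p' q' k' l' m' a' b'] v_adm w_adm [f f_iso].
have [[_ _ k0 l0 m0] _] := v_adm; have [[_ _ k'0 l'0 m'0] _] := w_adm.
have [f_C1|f_C2] := iso_cylinders k0 l0 m0 k'0 l'0 m'0 f_iso.
  by left; exact: iso_params_eq v_adm w_adm f_iso f_C1.
right; apply: (iso_params_eq v_adm (admissible_exchange w_adm)
  (gluing_iso_comp f_iso (gluing_iso_exchange _ _ _ _ _ _ _))) => s.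
by rewrite in_C1_exchange f_C2 negbK.
Qed.

(** The three cases of [Sigma_C] say that (k, p, alpha) is lexicographically at most (m, q, beta).
    This order is total, and the exchange swaps the two triples. *)
Lemma Sigma_C_or_exchange n v :
  admissible n v -> Sigma_C n v \/ Sigma_C n (exchange_params v).
Proof.
move=> v_adm; have v_adm' := admissible_exchange v_adm.
suff [v_S|v_S] : [\/ S1 v, S2 v | S3 v] \/
    [\/ S1 (exchange_params v), S2 (exchange_params v) | S3 (exchange_params v)].
- by left.
- by right.
case: v {v_adm v_adm'} => p q k l m a b; rewrite /S1 /S2 /S3 /=.
have [km|mk|->] := ltngtP k m; [by left; constructor 1 | by right; constructor 1 |].
have [pq|qp|->] := ltngtP p q; [by left; constructor 2 | by right; constructor 2 |].
by have [ab|/ltnW ba] := leqP a b; [left | right]; constructor 3.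
Qed.

(** By antisymmetry of the lexicographic order the two triples coincide. *)
Lemma Sigma_C_exchange n v :
  Sigma_C n v -> Sigma_C n (exchange_params v) -> exchange_params v = v.
Proof.
case: v => p q k l m a b [_ +] [_ +]; rewrite /S1 /S2 /S3 /=.
move=> v_S v'_S; suff [-> -> ->] : [/\ p = q, k = m & a = b] by [].
by case: v_S => [?|[? ?]|[? ? ?]]; case: v'_S => [?|[? ?]|[? ? ?]]; split; lia.
Qed.

Lemma in_H11_surface_of v : positive_params v -> in_H11 (surface_of v).
Proof. by case: v => p q k l m a b [_ _ k0 l0 m0]; exact: in_H11_diagram. Qed.

Lemma n_square_surface_of n v : admissible n v -> n_square_surface n (surface_of v).
Proof.
case: v => p q k l m a b [[p0 q0 _ l0 _] [<- _ _]].
by split; [exact: card_diagram | exact: connected_diagram].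
Qed.

Lemma isomorphic_card S S' : isomorphic S S' -> #|S| = #|S'|.
Proof. by move=> [f [f_bij _ _]]; exact: bij_eq_card f_bij. Qed.

(** [has_diagram_C] leaves the twists unbounded; reducing them modulo the circumferences does not
    change the surface, and counting squares gives the area equation. *)
Lemma has_diagram_C_admissible S : has_diagram_C S ->
  exists2 v, admissible #|S| v & isomorphic S (surface_of v).
Proof.
move=> [[p q k l m a b] [v_pos S_iso]].
exists (Params p q k l m (a %% (k + l)) (b %% (m + l))); last first.
  exact: isomorphic_trans S_iso (isomorphic_modn _ _ _ _ _ _ _).
split=> //; case: (v_pos) => p0 q0 k0 l0 m0.
rewrite (isomorphic_card S_iso) card_diagram //.
by split; rewrite // ?[l + m]addnC ltn_pmod // addn_gt0 ?k0 ?m0.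
Qed.

Theorem proposition3p6 (n : nat) (hn : 0 < n) :
  (forall v : params, Sigma_C n v ->
     [/\ n_square_surface n (surface_of v), in_H11 (surface_of v)
       & has_diagram_C (surface_of v)]) /\
  (forall S : square_gluing,
     n_square_surface n S -> in_H11 S -> has_diagram_C S ->
     exists! v : params, Sigma_C n v /\ isomorphic S (surface_of v)).
Proof.
split=> [v [v_adm _]|S [<- _] _ /has_diagram_C_admissible[w w_adm Sw]].
  have [v_pos _] := v_adm; split; first exact: n_square_surface_of.
    exact: in_H11_surface_of.
  by exists v; split=> //; exists id; split=> //; exists id.
have [v [v_Sigma Sv]] : exists v, Sigma_C #|S| v /\ isomorphic S (surface_of v).
  have [w_S|w_S] := Sigma_C_or_exchange w_adm; first by exists w.
  exists (exchange_params w); split=> //.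
  exact: isomorphic_trans Sw (isomorphic_exchange w).
exists v; split=> // u [u_Sigma Su].
have vu := isomorphic_trans (isomorphic_sym Sv) Su.
(* In the remaining case [v] is the exchange of [u]; both lie in [Sigma_C], so [u] is fixed by the
   exchange. *)
case: (isomorphic_admissible (proj1 v_Sigma) (proj1 u_Sigma) vu) => // vE.
by rewrite vE in v_Sigma *; rewrite (Sigma_C_exchange u_Sigma v_Sigma).
Qed.
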